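(* Let $\mathfrak g=\bigoplus_{i\in\mathbb Z}\mathfrak g_i$ be a graded Lie algebra over $\mathbb C$ with local part $\Gamma(\mathfrak g)=\mathfrak g_{-1}\oplus\mathfrak g_0\oplus\mathfrak g_1$. Let $B_{\Gamma(\mathfrak g)}$ be a non-degenerate invariant symmetric bilinear form on $\Gamma(\mathfrak g)$ such that $B_{\Gamma(\mathfrak g)}(\mathfrak g_i,\mathfrak g_j)=0$ when $|i+j|\ne 0$. Then, using $B_{\Gamma(\mathfrak g)}$, the contragredient representation $(\mathfrak g_0,\mathfrak g_1^* )$ can be identified with $(\mathfrak g_0,\mathfrak g_{-1})$. If $B_0$ denotes the restriction of $B_{\Gamma(\mathfrak g)}$ to $\mathfrak g_0$, then $$\mathfrak g_{min}(\Gamma(\mathfrak g))\simeq\mathfrak g_{min}(\Gamma(\mathfrak g_0,B_0,\mathfrak g_1))$$ (isomorphism of graded Lie algebras, $\mathfrak g_1$ being a $\mathfrak g_0$-module through the bracket). Moreover, suppose in addition that $\mathfrak g$ is a finite-dimensional reductive Lie algebra (with the given $\mathbb Z$-grading, $\mathfrak g$ being generated by its local part $\Gamma(\mathfrak g)$). Then $$\mathfrak g\simeq\mathfrak g_{min}(\Gamma(\mathfrak g))\simeq\mathfrak g_{min}(\Gamma(\mathfrak g_0,B_0,\mathfrak g_1)).$$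
   Context: All vector spaces and Lie algebras are over $\mathbb C$. A graded Lie algebra is a Lie algebra $\mathfrak g=\bigoplus_{i\in\mathbb Z}\mathfrak g_i$ with $\dim\mathfrak g_i<\infty$, $[\mathfrak g_i,\mathfrak g_j]\subset\mathfrak g_{i+j}$, generated by its local part $\mathfrak g_{-1}\oplus\mathfrak g_0\oplus\mathfrak g_1$. A local Lie algebra is a direct sum $\Gamma=\mathfrak g_{-1}\oplus\mathfrak g_0\oplus\mathfrak g_1$ of finite-dimensional spaces with bilinear anticommutative brackets $\mathfrak g_i\times\mathfrak g_j\to\mathfrak g_{i+j}$ for $i,j\in\{-1,0,1\}$ with $|i+j|\le1$, such that the Jacobi identity holds each time its three terms are defined. A symmetric bilinear form $B$ on a local Lie algebra is invariant if $B([x,y],z)=B(x,[y,z])$ each time the brackets are defined. Morphisms of graded (resp. local) Lie algebras are degree-preserving linear maps compatible with all (defined) brackets. By a theorem of Kac, for every local Lie algebra $\Gamma$ there is a unique graded Lie algebra $\mathfrak g_{max}(\Gamma)$ with local part $\Gamma$ such that every morphism of local Lie algebras from $\Gamma$ to the local part of a graded Lie algebra extends uniquely to a morphism of graded Lie algebras on $\mathfrak g_{max}(\Gamma)$. It has a unique maximal graded ideal $J_{max}$ with $J_{max}\cap\Gamma=\{0\}$, and $\mathfrak g_{min}(\Gamma):=\mathfrak g_{max}(\Gamma)/J_{max}$, with local part $\Gamma$. For a finite-dimensional Lie algebra $\mathfrak g_0$ with a non-degenerate invariant symmetric bilinear form $B_0$ and a finite-dimensional representation $(\rho,V)$ of $\mathfrak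 g_0$, $\Gamma(\mathfrak g_0,B_0,V)=V^*\oplus\mathfrak g_0\oplus V$ (degrees $-1,0,1$) is the local Lie algebra with the bracket of $\mathfrak g_0$, $[U,X]=\rho(U)X$, $[U,Y]=\rho^*(U)Y$ ($\rho^*$ contragredient), and $[X,Y]\in\mathfrak g_0$ defined by $B_0([X,Y],U)=Y(\rho(U)X)$ for all $U\in\mathfrak g_0$ ($X\in V$, $Y\in V^*$). *)

(* Defs.v *)
From HB Require Import structures.
From mathcomp Require Import all_boot all_order all_algebra.
From mathcomp Require Import sesquilinear complex.
From mathcomp Require Import boolp classical_sets reals.

Set Implicit Arguments.
Unset Strict Implicit.
Unset Printing Implicit Defensive.

Import Order.TTheory GRing.Theory Num.Theory.
Local Open Scope ring_scope.

Definition is_lie (K : fieldType) (L : lmodType K) (br : L -> L -> L) : Prop :=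
  (forall x, br x x = 0) /\
  (forall x y z, br x (br y z) + br y (br z x) + br z (br x y) = 0).

Record lieAlg (K : fieldType) := LieAlg {
  lie_sort :> lmodType K;
  lie : {bilinear lie_sort -> lie_sort -> lie_sort};
  lieP : is_lie lie }.

Record finLie (K : fieldType) := FinLie {
  finLie_sort :> vectType K;
  fbr : {bilinear finLie_sort -> finLie_sort -> finLie_sort};
  fbrP : is_lie fbr }.

Arguments lie {K l}.
Arguments fbr {K f}.

Record lieRep (K : fieldType) (g0 : finLie K) := LieRep {
  rep_sort :> vectType K;
  act : {bilinear g0 -> rep_sort -> rep_sort};
  actP : forall u v x, act (fbr u v) x = act u (act v x) - act v (act u x) }.

Arguments act {K g0 l}.

Record invForm (K : fieldType) (g0 : finLie K) := InvForm {
  form :> {biscalar g0};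
  form_sym : forall u v, form u v = form v u;
  form_inv : forall u v w, form (fbr u v) w = form u (fbr v w);
  form_nondeg : forall u, (forall v, form u v = 0) -> u = 0 }.

Definition rep_iso (K : fieldType) (g0 : finLie K) (V W : lieRep g0)
    (f : V -> W) : Prop :=
  linear f /\ bijective f /\ forall u x, f (act u x) = act u (f x).

Section LieSub.
Variables (K : fieldType) (L : lieAlg K).

Definition is_subspace (S : set L) : Prop :=
  S 0 /\ (forall a x y, S x -> S y -> S (a *: x + y)).

Definition is_subalgebra (S : set L) : Prop :=
  is_subspace S /\ (forall x y, S x -> S y -> S (lie x y)).

Definition is_ideal (S : set L) : Prop :=
  is_subspace S /\ (forall x y, S y -> S (lie x y)).

Definition fin_dim : Prop :=
  exists (n : nat) (e : 'I_n -> L),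
    forall x, exists c : 'I_n -> K, x = \sum_(i < n) c i *: e i.

(* Reductive: the adjoint representation is semisimple, i.e. every ideal has a
   complementary ideal (Bourbaki's definition). *)
Definition reductive : Prop :=
  forall I : set L, is_ideal I ->
    exists I' : set L, is_ideal I' /\
      (forall x, exists y z, I y /\ I' z /\ x = y + z) /\
      (forall x, I x -> I' x -> x = 0).

End LieSub.

(* The decomposition is given by the spaces [gpart i] together with the
   inclusions [ginj i] and the projections [gproj i]; the homogeneous subspace
   of degree i is the image of [ginj i], and [gpart i : vectType K] makes it
   finite-dimensional. *)
Record gradedLie (K : fieldType) := GradedLie {
  glie :> lieAlg K;
  gpart : int -> vectType K;
  ginj : forall i, {linear gpart i -> glie};
  gproj : forall i, {linear glie -> gpart i};
  ginjK : forall i x, gproj i (ginj i x) = x;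
  ginj_neq : forall i j x, i != j -> gproj j (ginj i x) = 0;
  gdecomp : forall x : glie, exists2 s : seq int, uniq s &
    x = \sum_(i <- s) ginj i (gproj i x);
  gbr_deg : forall i j (x : gpart i) (y : gpart j),
    exists z : gpart (i + j), lie (ginj i x) (ginj j y) = ginj (i + j) z;
  ggen : forall S : set glie, is_subalgebra S ->
    (forall x, S (ginj (-1) x)) -> (forall x, S (ginj 0 x)) ->
    (forall x, S (ginj 1 x)) -> forall x, S x }.

Arguments gpart {K}.
Arguments ginj {K} g i.
Arguments gproj {K} g i.

(* An element of a direct sum of three spaces in degrees -1, 0, 1 is a triple
   ((y, u), x); [lhom i w] says that w is homogeneous of degree i. *)
Inductive lhom (A B C : nmodType) : int -> A * B * C -> Prop :=
  | Lneg y : lhom (-1) (y, 0, 0)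
  | Lzero u : lhom 0 (0, u, 0)
  | Lpos x : lhom 1 (0, 0, x).

Lemma lhom0E (A B C : nmodType) (i : int) (w : A * B * C) :
  lhom i w -> i = 0 -> w = (0, w.1.2, 0).
Proof. by case. Qed.

Lemma triple_ext (A B C : Type) (s t : A * B * C) :
  s.1.1 = t.1.1 -> s.1.2 = t.1.2 -> s.2 = t.2 -> s = t.
Proof. by case: s t => [[? ?] ?] [[? ?] ?] /= -> -> ->. Qed.

(* The bracket [lbr] is only meaningful on pairs of homogeneous elements of
   degrees i, j with |i + j| <= 1; all axioms, invariance and morphism
   conditions refer to such pairs only, and the values on two elements of
   degree 1, or of degree -1, carry no information. *)
Record localLie (K : fieldType) := LocalLie {
  lneg : vectType K;
  lzero : vectType K;
  lpos : vectType K;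
  lbr : {bilinear (lneg * lzero * lpos) -> (lneg * lzero * lpos)
           -> (lneg * lzero * lpos)};
  lbr_deg : forall (i j : int) x y, lhom i x -> lhom j y ->
    `|i + j| <= 1 -> lhom (i + j) (lbr x y);
  lbr_anti : forall (i j : int) x y, lhom i x -> lhom j y ->
    `|i + j| <= 1 -> lbr x y = - lbr y x;
  lbr_jacobi : forall (i j k : int) x y z, lhom i x -> lhom j y -> lhom k z ->
    `|i + j| <= 1 -> `|j + k| <= 1 -> `|k + i| <= 1 -> `|i + j + k| <= 1 ->
    lbr x (lbr y z) + lbr y (lbr z x) + lbr z (lbr x y) = 0 }.

Arguments lbr {K l}.

Definition ltot (K : fieldType) (G : localLie K) : vectType K :=
  (lneg G * lzero G * lpos G)%type.

Section LocalForm.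
Variables (K : fieldType) (G : localLie K) (B : {biscalar (ltot G)}).

Definition is_nondeg_inv_sym_form : Prop :=
  (forall x y, B x y = B y x) /\
  (forall (i j k : int) x y z, lhom i x -> lhom j y -> lhom k z ->
     `|i + j| <= 1 -> `|j + k| <= 1 -> B (lbr x y) z = B x (lbr y z)) /\
  (forall x, (forall y, B x y = 0) -> x = 0).

Definition is_graded_form : Prop :=
  forall (i j : int) x y, lhom i x -> lhom j y -> `|i + j| != 0 -> B x y = 0.

End LocalForm.

Definition local_morph (K : fieldType) (G H : localLie K)
    (f : ltot G -> ltot H) : Prop :=
  [/\ linear f,
      forall (i : int) x, lhom i x -> lhom i (f x) &
      forall (i j : int) x y, lhom i x -> lhom j y -> `|i + j| <= 1 ->
        f (lbr x y) = lbr (f x) (f y)].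

Definition graded_morph (K : fieldType) (G H : gradedLie K)
    (f : G -> H) : Prop :=
  [/\ linear f,
      forall i x, exists y, f (ginj G i x) = ginj H i y &
      forall x y, f (lie x y) = lie (f x) (f y)].

Definition graded_iso (K : fieldType) (G H : gradedLie K) : Prop :=
  exists2 f : G -> H, graded_morph f & bijective f.

Section LieLemmas.
Variables (K : fieldType) (L : lmodType K) (br : {bilinear L -> L -> L}).
Hypothesis brP : is_lie br.

Lemma lie_anti x y : br x y = - br y x.
Proof.
have [br0 _] := brP.
have := br0 (x + y).
rewrite linearDl /= !linearDr /= !br0 add0r addr0.
by move/eqP; rewrite addr_eq0 => /eqP.
Qed.

Lemma lie_der x y z : br (br x y) z = br x (br y z) - br y (br x z).
Proof.
have [_ /(_ x y z)] := brP.
rewrite (lie_anti z (br x y)) (lie_anti z x) linearNr /=.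
by move/eqP; rewrite subr_eq0 => /eqP.
Qed.

End LieLemmas.

Section LocalPart.
Variables (K : fieldType) (g : gradedLie K).

Definition ltriple : vectType K := (gpart g (-1) * gpart g 0 * gpart g 1)%type.

Definition gemb (w : ltriple) : g :=
  ginj g (-1) w.1.1 + ginj g 0 w.1.2 + ginj g 1 w.2.

Definition gtrunc (x : g) : ltriple :=
  (gproj g (-1) x, gproj g 0 x, gproj g 1 x).

Lemma gemb_linear : linear gemb.
Proof.
move=> a x y; rewrite /gemb !linearP !scalerDr.
by rewrite [RHS]addrACA; congr (_ + _); rewrite addrACA.
Qed.
HB.instance Definition _ :=
  GRing.isLinear.Build K ltriple g _ gemb gemb_linear.

Lemma gtrunc_linear : linear gtrunc.
Proof. by move=> a x y; rewrite /gtrunc !linearP. Qed.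
HB.instance Definition _ :=
  GRing.isLinear.Build K g ltriple _ gtrunc gtrunc_linear.

Definition gbr (x y : ltriple) : ltriple := gtrunc (lie (gemb x) (gemb y)).

Lemma gbr_bilinear : bilinear_for *:%R *:%R gbr.
Proof.
split=> u a x y /=; rewrite /gbr.
  by rewrite linearP linearPl linearP.
by rewrite linearP linearPr linearP.
Qed.
HB.instance Definition _ :=
  bilinear_isBilinear.Build K ltriple ltriple ltriple _ _ gbr gbr_bilinear.

Lemma gemb_hom (i : int) (x : ltriple) :
  lhom i x -> exists z, gemb x = ginj g i z.
Proof.
by case=> z; exists z; rewrite /gemb /= !linear0 ?addr0 ?add0r.
Qed.

Lemma gtrunc_hom (i : int) (z : gpart g i) :
  `|i| <= 1 -> lhom i (gtrunc (ginj g i z)) /\ gemb (gtrunc (ginj g i z)) = ginj g i z.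
Proof.
move=> hi.
have [|[]] : i = -1 \/ i = 0 \/ i = 1.
  case: i z hi => [[|[|n]]|[|n]] //= _ _; [by right; left | by right; right | by left].
all: move=> e; subst i; rewrite /gtrunc /gemb /= !ginjK !ginj_neq //.
all: by rewrite !linear0 ?addr0 ?add0r; split=> //; constructor.
Qed.

Lemma gbr_hom (i j : int) (x y : ltriple) : lhom i x -> lhom j y ->
  `|i + j| <= 1 -> lhom (i + j) (gbr x y) /\ gemb (gbr x y) = lie (gemb x) (gemb y).
Proof.
move=> /gemb_hom[x' ex] /gemb_hom[y' ey] hij.
have [z ez] := gbr_deg x' y'.
by rewrite /gbr ex ey ez; apply: gtrunc_hom.
Qed.

Lemma gbr_deg_local (i j : int) x y : lhom i x -> lhom j y ->
  `|i + j| <= 1 -> lhom (i + j) (gbr x y).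
Proof. by move=> hx hy hij; have [] := gbr_hom hx hy hij. Qed.

Lemma gbr_anti (i j : int) x y : lhom i x -> lhom j y ->
  `|i + j| <= 1 -> gbr x y = - gbr y x.
Proof.
by move=> _ _ _; rewrite /gbr (lie_anti (lieP g)) linearN.
Qed.

Lemma gbr_jacobi (i j k : int) x y z :
  lhom i x -> lhom j y -> lhom k z ->
  `|i + j| <= 1 -> `|j + k| <= 1 -> `|k + i| <= 1 -> `|i + j + k| <= 1 ->
  gbr x (gbr y z) + gbr y (gbr z x) + gbr z (gbr x y) = 0.
Proof.
move=> hx hy hz hij hjk hki _.
have [_ exy] := gbr_hom hx hy hij.
have [_ eyz] := gbr_hom hy hz hjk.
have [_ ezx] := gbr_hom hz hx hki.
rewrite {1 3 5}/gbr exy eyz ezx -!linearD /=.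
by have [_ ->] := lieP g; rewrite linear0.
Qed.

Definition local_part : localLie K :=
  @LocalLie K (gpart g (-1)) (gpart g 0) (gpart g 1)
    gbr gbr_deg_local gbr_anti gbr_jacobi.

Definition act_deg i (u : gpart g 0) (x : gpart g i) : gpart g i :=
  gproj g i (lie (ginj g 0 u) (ginj g i x)).

Lemma act_deg_bilinear i : bilinear_for *:%R *:%R (@act_deg i).
Proof.
split=> u a x y /=; rewrite /act_deg.
  by rewrite linearP linearPl linearP.
by rewrite linearP linearPr linearP.
Qed.
HB.instance Definition _ i :=
  bilinear_isBilinear.Build K _ _ _ _ _ (@act_deg i) (@act_deg_bilinear i).

Lemma act_degE i u (x : gpart g i) :
  ginj g i (act_deg u x) = lie (ginj g 0 u) (ginj g i x).
Proof.
have := gbr_deg u x; rewrite /act_deg add0r => -[z ->].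
by rewrite ginjK.
Qed.

Lemma deg0_lie : is_lie (@act_deg 0).
Proof.
have [l0 lJ] := lieP g; split=> [x|x y z].
  by rewrite /act_deg l0 linear0.
apply: (can_inj (@ginjK _ g 0)).
by rewrite !linearD /= !act_degE lJ linear0.
Qed.

Definition deg0_alg : finLie K := @FinLie K (gpart g 0) (@act_deg 0) deg0_lie.

Lemma deg_rep_subproof i (u v : deg0_alg) (x : gpart g i) :
  act_deg (fbr u v) x = act_deg u (act_deg v x) - act_deg v (act_deg u x).
Proof.
apply: (can_inj (@ginjK _ g i)).
have := lie_der (lieP g) (ginj g 0 u) (ginj g 0 v) (ginj g i x).
by rewrite -!act_degE -linearB.
Qed.

(* [deg0_alg]-module structure of the degree i component, by the bracket. *)
Definition deg_rep i : lieRep deg0_alg :=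
  @LieRep K deg0_alg (gpart g i) (@act_deg i) (@deg_rep_subproof i).

Section Restriction.
Variables (B : {biscalar (ltot local_part)}) (Binv : is_nondeg_inv_sym_form B)
  (Bgr : is_graded_form B).

Definition form0 (u v : deg0_alg) : K := B (0, u, 0) (0, v, 0).

Lemma zero_linear a (u v : gpart g 0) :
  (0, a *: u + v, 0) = a *: (0, u, 0) + (0, v, 0) :> ltriple.
Proof.
by congr (_, _, _); rewrite /= scaler0 add0r.
Qed.

Lemma form0_bilinear : bilinear_for *%R *%R form0.
Proof.
split=> u a x y; rewrite /form0 zero_linear.
  by rewrite linearPl.
by rewrite linearPr.
Qed.
HB.instance Definition _ :=
  bilinear_isBilinear.Build K deg0_alg deg0_alg K _ _ form0 form0_bilinear.

Lemma form0_sym u v : form0 u v = form0 v u.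
Proof. by have [Bs _] := Binv; rewrite /form0 Bs. Qed.

Lemma gbr0E (u v : deg0_alg) : (0, fbr u v, 0) = gbr (0, u, 0) (0, v, 0).
Proof.
have hu : lhom 0 ((0, u, 0) : ltriple) by constructor.
have hv : lhom 0 ((0, v, 0) : ltriple) by constructor.
have := gbr_deg_local hu hv; rewrite addr0 normr0 => /(_ ler01).
have -> : fbr u v = (gbr (0, u, 0) (0, v, 0)).1.2.
  by rewrite /gbr /= /act_deg /gemb /= !linear0 !addr0 !add0r.
by move/lhom0E/(_ erefl).
Qed.

Lemma form0_inv u v w : form0 (fbr u v) w = form0 u (fbr v w).
Proof.
have [_ [Bi _]] := Binv; rewrite /form0 !gbr0E.
by apply: (Bi 0 0 0) => //; constructor.
Qed.

Lemma form0_nondeg u : (forall v, form0 u v = 0) -> u = 0.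
Proof.
have [_ [_ Bn]] := Binv => h.
have e0 : ((0, u, 0) : ltot local_part) = 0; last by case: e0.
apply: Bn => -[[y v] x].
have -> : (y, v, x) = (y, 0, 0) + (0, v, 0) + (0, 0, x) :> ltot local_part.
  by congr (_, _, _); rewrite /= ?addr0 ?add0r.
have hu : lhom 0 ((0, u, 0) : ltriple) by constructor.
rewrite !linearDr /= [X in _ + X + _]h addr0.
rewrite (Bgr hu (Lneg _ _ y)) // (Bgr hu (Lpos _ _ x)) //.
by rewrite addr0.
Qed.

Definition restr_form0 : invForm deg0_alg :=
  @InvForm K deg0_alg form0 form0_sym form0_inv form0_nondeg.

End Restriction.
End LocalPart.

Section Contragredient.
Variables (K : fieldType) (g0 : finLie K) (V : lieRep g0).

Definition dual : vectType K := 'Hom(V, K^o).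

Definition coact_fun (u : g0) (Y : dual) (x : V) : K^o := - Y (act u x).

Lemma coact_fun_linear u Y : linear (coact_fun u Y).
Proof.
by move=> a x y; rewrite /coact_fun linearPr linearP opprD scalerN.
Qed.
HB.instance Definition _ u Y :=
  GRing.isLinear.Build K V K^o _ (coact_fun u Y) (coact_fun_linear u Y).

Definition coact (u : g0) (Y : dual) : dual := linfun (coact_fun u Y).

Lemma coactE u Y x : coact u Y x = - Y (act u x).
Proof. by rewrite lfunE. Qed.

Lemma coact_bilinear : bilinear_for *:%R *:%R coact.
Proof.
split=> [Y a u v|u a Y Z]; apply/lfunP => x /=.
  rewrite add_lfunE scale_lfunE !coactE linearPl linearP.
  by rewrite opprD scalerN.
by rewrite add_lfunE scale_lfunE !coactE add_lfunE scale_lfunE opprD scalerN.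
Qed.
HB.instance Definition _ :=
  bilinear_isBilinear.Build K g0 dual dual _ _ coact coact_bilinear.

Lemma coactP u v Y :
  coact (fbr u v) Y = coact u (coact v Y) - coact v (coact u Y).
Proof.
apply/lfunP => x; rewrite add_lfunE opp_lfunE !coactE actP linearB /=.
by rewrite !opprK opprB addrC.
Qed.

Definition contragredient : lieRep g0 := @LieRep K g0 dual coact coactP.

End Contragredient.

Section Gamma.
Variables (K : fieldType) (g0 : finLie K) (B0 : invForm g0) (V : lieRep g0).

Lemma moment_ex (x : V) (Y : dual V) :
  exists w : g0, forall u, B0 w u = Y (act u x).
Proof.
pose bf (w u : g0) : K^o := B0 w u.
have bfl w : linear (bf w) by move=> a u v; rewrite /bf linearPr.
pose bL w : {linear g0 -> K^o} :=
  HB.pack (bf w) (GRing.isLinear.Build K g0 K^o _ (bf w) (bfl w)).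
pose h w : 'Hom(g0, K^o) := linfun (bL w).
have hE w u : h w u = B0 w u by rewrite lfunE.
have hl : linear h.
  move=> a w w'; apply/lfunP => u.
  by rewrite add_lfunE scale_lfunE !hE linearPl.
pose hL : {linear g0 -> 'Hom(g0, K^o)} :=
  HB.pack h (GRing.isLinear.Build K g0 'Hom(g0, K^o) _ h hl).
pose H : 'Hom(g0, 'Hom(g0, K^o)) := linfun hL.
have HE w : H w = h w by rewrite lfunE.
have kerH : lker H == 0%VS.
  apply/lker0P => w w'; rewrite !HE => e; apply/eqP; rewrite -subr_eq0.
  apply/eqP/(@form_nondeg _ _ B0) => u; rewrite linearBl /= -!hE e.
  by rewrite subrr.
have limH : limg H = fullv.
  apply/eqP; rewrite eqEdim subvf /= limg_dim_eq ?(eqP kerH) ?capv0 //.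
  by rewrite !dimvf /dim /= muln1.
pose fY (u : g0) : K^o := Y (act u x).
have fYl : linear fY by move=> a u v; rewrite /fY linearPl linearP.
pose fL : {linear g0 -> K^o} :=
  HB.pack fY (GRing.isLinear.Build K g0 K^o _ fY fYl).
have /memv_imgP[w _ ew] : linfun fL \in limg H by rewrite limH memvf.
exists w => u; rewrite -hE -HE -ew.
by rewrite lfunE.
Qed.

(* [moment x Y] is the bracket [x, Y] in g0 of x in V and Y in V^*. *)
Definition moment (x : V) (Y : dual V) : g0 := projT1 (cid (moment_ex x Y)).

Lemma momentE x Y u : B0 (moment x Y) u = Y (act u x).
Proof. exact: (projT2 (cid (moment_ex x Y))). Qed.

Lemma form_inj w w' : (forall u, B0 w u = B0 w' u) -> w = w'.
Proof.
move=> e; apply/eqP; rewrite -subr_eq0.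
by apply/eqP/(@form_nondeg _ _ B0) => u; rewrite linearBl /= e subrr.
Qed.

Lemma moment_bilinear : bilinear_for *:%R *:%R moment.
Proof.
split=> [Y a x y|x a Y Z]; apply: form_inj => u; rewrite linearPl /= !momentE.
  by rewrite linearPr linearP.
by rewrite add_lfunE scale_lfunE.
Qed.
HB.instance Definition _ :=
  bilinear_isBilinear.Build K V (dual V) g0 _ _ moment moment_bilinear.

Lemma momentJ u x Y :
  fbr u (moment x Y) = moment x (coact u Y) + moment (act u x) Y.
Proof.
apply: form_inj => w; rewrite linearDl /= !momentE coactE.
rewrite (lie_anti (fbrP g0)) linearNl /= form_inv momentE actP linearB /=.
by rewrite opprB addrC.
Qed.

Definition Gtriple : vectType K := (dual V * g0 * V)%type.

(* The remaining brackets [X, U], [Y, U], [Y, X] are forced by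
   anticommutativity; V x V and V^* x V^* are sent to 0 (junk values). *)
Definition Gbr (s t : Gtriple) : Gtriple :=
  (coact s.1.2 t.1.1 - coact t.1.2 s.1.1,
   fbr s.1.2 t.1.2 + (moment s.2 t.1.1 - moment t.2 s.1.1),
   act s.1.2 t.2 - act t.1.2 s.2).

Lemma Gbr_bilinear : bilinear_for *:%R *:%R Gbr.
Proof.
have aux (W : lmodType K) a (p q r s : W) :
    a *: p + q - (a *: r + s) = a *: (p - r) + (q - s).
  by rewrite scalerBr opprD addrACA.
split=> u a x y; apply: triple_ext;
  rewrite /= ?linearPl ?linearPr /= ?aux //.
  by rewrite [in RHS]scalerDr addrACA.
by rewrite [in RHS]scalerDr addrACA.
Qed.
HB.instance Definition _ :=
  bilinear_isBilinear.Build K Gtriple Gtriple Gtriple _ _ Gbr Gbr_bilinear.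

Local Notation Gsimp := (linear0l, linear0r, linearNl, linearNr, subr0, sub0r, addr0,
  add0r, oppr0, opprK).

Lemma Gbr_deg (i j : int) (x y : Gtriple) : lhom i x -> lhom j y ->
  `|i + j| <= 1 -> lhom (i + j) (Gbr x y).
Proof.
case=> [Y|u|X]; case=> [Z|v|W] //= _; rewrite /Gbr /= !Gsimp; by constructor.
Qed.

Lemma Gbr_anti (i j : int) (x y : Gtriple) : lhom i x -> lhom j y ->
  `|i + j| <= 1 -> Gbr x y = - Gbr y x.
Proof.
move=> _ _ _; apply: triple_ext; rewrite /= ?opprB //.
by rewrite opprD opprB (lie_anti (fbrP g0)).
Qed.

Lemma Gbr_jacobi (i j k : int) (x y z : Gtriple) :
  lhom i x -> lhom j y -> lhom k z ->
  `|i + j| <= 1 -> `|j + k| <= 1 -> `|k + i| <= 1 -> `|i + j + k| <= 1 ->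
  Gbr x (Gbr y z) + Gbr y (Gbr z x) + Gbr z (Gbr x y) = 0.
Proof.
case=> [Y1|u1|X1]; case=> [Y2|u2|X2]; case=> [Y3|u3|X3] // _ _ _ _;
  apply: triple_ext; rewrite /= ?Gsimp // ?coactP ?actP ?momentJ.
- by rewrite opprB subrK subrr.
- by rewrite [X in - _ + X]addrC addKr subrr.
- by rewrite [X in - X]addrC subrr.
- by rewrite opprB addKr addNr.
- by rewrite opprD subrK addNr.
- by rewrite subrr.
- by have [_ ->] := fbrP g0.
- by rewrite subrr.
- by rewrite [X in X - _ - _]addrC addrK subrr.
- by rewrite opprB addKr addNr.
- by rewrite -opprD addNr.
- by rewrite opprD addrA subrr add0r addNr.
- by rewrite opprB subrK subrr.
Qed.

Definition Gamma : localLie K :=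
  @LocalLie K (dual V) g0 V Gbr Gbr_deg Gbr_anti Gbr_jacobi.

End Gamma.

Definition local_iso (K : fieldType) (G H : localLie K)
    (f : ltot G -> ltot H) : Prop :=
  local_morph f /\ bijective f.

(* [G], with its local part identified with [Ga] through [iota], satisfies the
   universal property defining the maximal graded Lie algebra of [Ga]. *)
Definition is_gmax (K : fieldType) (Ga : localLie K) (G : gradedLie K)
    (iota : ltot Ga -> ltot (local_part G)) : Prop :=
  local_iso iota /\
  forall (H : gradedLie K) (f : ltot Ga -> ltot (local_part H)),
    local_morph f ->
    exists! F : G -> H,
      graded_morph F /\ forall w, F (gemb (iota w)) = gemb (f w).

Section MaxIdeal.
Variables (K : fieldType) (G : gradedLie K).

Definition is_graded_ideal (J : set G) : Prop :=
  is_ideal J /\ (forall i x, J x -> J (ginj G i (gproj G i x))).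

Definition meets_local_trivially (J : set G) : Prop :=
  forall w : ltot (local_part G), J (gemb w) -> gemb w = 0.

(* [J] is J_max, the largest graded ideal meeting the local part trivially. *)
Definition is_Jmax (J : set G) : Prop :=
  [/\ is_graded_ideal J, meets_local_trivially J &
      forall J' : set G, is_graded_ideal J' -> meets_local_trivially J' ->
        forall x, J' x -> J x].

End MaxIdeal.

(* [M] is the quotient of the maximal graded Lie algebra of [Ga] by J_max: it
   is the image of a surjective graded morphism with kernel J_max. *)
Definition is_gmin (K : fieldType) (Ga : localLie K) (M : gradedLie K) : Prop :=
  exists (G : gradedLie K) (iota : ltot Ga -> ltot (local_part G))
         (p : G -> M),
    [/\ is_gmax iota, graded_morph p, (forall y, exists x, p x = y) &
        is_Jmax (fun x => p x = 0)].

(* Main.v *)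
Require Import Defs.
From HB Require Import structures.
From mathcomp Require Import all_boot all_order all_algebra.
From mathcomp Require Import sesquilinear complex.
From mathcomp Require Import boolp classical_sets reals zify.

Import Order.TTheory GRing.Theory Num.Theory.
Local Open Scope ring_scope.

(** The identification of the contragredient of g_1 with g_(-1) is the map
    y |-> B(y, .); the grading of B makes the pairing of g_(-1) with g_1
    perfect, and invariance makes the map equivariant
    ([dual_identification], [dual_rep_iso]).  Together with the identity on
    g_0 and g_1 it is an isomorphism of local Lie algebras from the local part
    of g onto Gamma(g_0, B_0, g_1): the only bracket to examine is
    g_1 x g_(-1) -> g_0, and there the invariance of B gives
    B_0([x, y], u) = B(y, [u, x]), the equation that defines the bracket of
    Gamma ([local_part_Gamma]).

    Say that a graded Lie algebra is minimal if its only graded ideal meeting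
    the local part trivially is 0.  The quotient of g_max(Gamma) by J_max is
    minimal, since such an ideal pulls back to one contained in J_max
    ([gmin_minimal]).  Conversely, let N be minimal with local part isomorphic
    to Gamma.  The universal property gives a morphism g_max(Gamma) -> N; it
    is surjective because N is generated by its local part, and its kernel is
    J_max because the image of a competing ideal is an ideal of N meeting the
    local part trivially.  So N is isomorphic to g_min(Gamma)
    ([gmin_unique]).  The first isomorphism of the theorem follows.

    For the last claim it remains to see that a finite-dimensional reductive g
    is minimal ([reductive_minimal]).  Let I be a nonzero graded ideal
    meeting the local part trivially.  As I has no component of degree 0,
    its homogeneous elements act nilpotently, and an Engel argument for
    homogeneous elements ([engel_theorem]) gives a homogeneous z != 0 in I
    commuting with I, hence with g, because I has a complementary ideal.  The
    line K z is then an ideal; let C be a complementary ideal.  Since z is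
    central, [g, g] lies in C.  But g is generated by its local part, so each
    component of g of degree outside {-1, 0, 1} lies in [g, g]; as the degree
    of z is such a degree, z is in C, a contradiction. *)

Set Implicit Arguments.
Unset Strict Implicit.
Unset Printing Implicit Defensive.

(** * Linear maps, subspaces and homogeneous components *)

(** Replaces a function known to be linear by a bundled linear map, so that the
    lemmas on linear maps apply to it. *)
Lemma linear_ex (K : fieldType) (U V : lmodType K) (f : U -> V) :
  linear f -> exists h : {linear U -> V}, f = h.
Proof.
move=> fl.
by exists (HB.pack f (GRing.isLinear.Build K U V _ f fl) : {linear U -> V}).
Qed.

Section Subspaces.
Variables (K : fieldType) (L : lieAlg K).
Implicit Types S : set L.

Lemma subspace0 S : is_subspace S -> S 0. Proof. by case. Qed.

Lemma subspaceZ S a x : is_subspace S -> S x -> S (a *: x).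
Proof. by case=> S0 SP Sx; rewrite -[_ *: _]addr0; apply: SP. Qed.

Lemma subspaceD S x y : is_subspace S -> S x -> S y -> S (x + y).
Proof. by case=> S0 SP Sx Sy; rewrite -[x]scale1r; apply: SP. Qed.

Lemma subspace_sum S (I : eqType) (r : seq I) (F : I -> L) :
  is_subspace S -> (forall i, i \in r -> S (F i)) -> S (\sum_(i <- r) F i).
Proof.
move=> Ssub SF; rewrite big_seq; elim/big_ind: _ => //.
  exact: subspace0.
by move=> x y; apply: subspaceD.
Qed.

Lemma lieC (x y : L) : lie x y = - lie y x.
Proof. exact: lie_anti (lieP L) x y. Qed.

Lemma liexx (x : L) : lie x x = 0.
Proof. by have [-> _] := lieP L. Qed.

Lemma ideal_lieC S x y : is_ideal S -> S x -> S (lie x y).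
Proof.
case=> Ssub Sid Sx; rewrite lieC -scaleN1r.
by apply: subspaceZ => //; apply: Sid.
Qed.

End Subspaces.

Section HomogeneousComponents.
Variables (K : fieldType) (g : gradedLie K).

Definition hcomp i (x : g) : g := ginj g i (gproj g i x).

Lemma hcomp_linear i : linear (hcomp i).
Proof. by move=> a x y; rewrite /hcomp !linearP. Qed.
HB.instance Definition _ i :=
  GRing.isLinear.Build K g g _ (hcomp i) (hcomp_linear i).

Definition homog i (x : g) := hcomp i x = x.

Lemma hcomp_inj i j z : hcomp i (ginj g j z) = if i == j then ginj g j z else 0.
Proof.
rewrite /hcomp; have [->|ne] := eqVneq i j; first by rewrite ginjK.
by rewrite ginj_neq 1?eq_sym // linear0.
Qed.

Lemma homog_inj i z : homog i (ginj g i z).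
Proof. by rewrite /homog hcomp_inj eqxx. Qed.

Lemma homog_hcomp i x : homog i (hcomp i x).
Proof. exact: homog_inj. Qed.

Lemma hcomp_homog i j x : homog j x -> hcomp i x = if i == j then x else 0.
Proof. by rewrite /homog => <-; rewrite hcomp_inj. Qed.

Lemma hcomp_decomp (x : g) : exists2 s : seq int, uniq s &
  x = \sum_(i <- s) hcomp i x.
Proof. exact: gdecomp. Qed.

Lemma homog_lie i j x y : homog i x -> homog j y -> homog (i + j) (lie x y).
Proof.
move=> <- <-; have [z ->] := gbr_deg (gproj g i x) (gproj g j y).
exact: homog_inj.
Qed.

Lemma gembE w : gemb w = ginj g (-1) w.1.1 + ginj g 0 w.1.2 + ginj g 1 w.2.
Proof. by []. Qed.

Lemma gemb_trunc (x : g) :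
  gemb (gtrunc x) = hcomp (-1) x + hcomp 0 x + hcomp 1 x.
Proof. by []. Qed.

Lemma gembK : cancel (@gemb K g) (@gtrunc K g).
Proof.
move=> w; apply: triple_ext => /=; rewrite /gemb !linearD /= ginjK !ginj_neq //.
- by rewrite !addr0.
- by rewrite addr0 add0r.
- by rewrite !add0r.
Qed.

End HomogeneousComponents.

(** * Morphisms of graded Lie algebras *)

Section GradedMorphisms.
Variables (K : fieldType) (G H : gradedLie K) (p : G -> H).
Hypothesis pm : graded_morph p.

Lemma morph_lin : linear p. Proof. by case: pm. Qed.

Lemma morph0 : p 0 = 0.
Proof. by have [h ->] := linear_ex morph_lin; rewrite linear0. Qed.

Lemma morphB x y : p (x - y) = p x - p y.
Proof. by have [h ->] := linear_ex morph_lin; rewrite linearB. Qed.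

(** Preservation of degrees is only given on each g_i; decomposing x into
    homogeneous components turns it into an equation valid for every x. *)
Lemma morph_hcomp i x : p (hcomp i x) = hcomp i (p x).
Proof.
have [s su ex] := hcomp_decomp x.
have hp j y : hcomp i (p (hcomp j y)) = if i == j then p (hcomp j y) else 0.
  have [_ /(_ j (gproj G j y)) [z ez] _] := pm.
  by rewrite /hcomp ez -/(hcomp _ _) hcomp_inj.
have pl := morph_lin; have [h eh] := linear_ex pl.
rewrite [in RHS]ex eh !linear_sum /= -eh.
under eq_bigr => j _ do rewrite hp.
have [si|si] := boolP (i \in s).
  rewrite (bigD1_seq i) //= eqxx big1 ?addr0 // => j.
  by rewrite eq_sym => /negPf ->.
have -> : hcomp i x = 0.
  rewrite ex linear_sum big_seq big1 //= => j js.
  rewrite (hcomp_homog _ (homog_hcomp _ _)); case: eqP => // e.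
  by rewrite e js in si.
rewrite morph0 big_seq big1 // => j js; case: eqP => // e.
by rewrite e js in si.
Qed.

Lemma morph_gemb w : p (gemb w) = gemb (gtrunc (p (gemb w))).
Proof.
rewrite gemb_trunc -!morph_hcomp; have [h ->] := linear_ex morph_lin.
by rewrite -!linearD /= -gemb_trunc gembK.
Qed.

Lemma local_morph_trunc :
  @local_morph K (local_part G) (local_part H) (fun w => gtrunc (p (gemb w))).
Proof.
split.
- by have [h ->] := linear_ex morph_lin => a x y; rewrite !linearP.
- have [_ pd _] := pm => i x xi.
  have i1 : `|i| <= 1 by case: xi.
  have [z ->] := gemb_hom xi; have [z' ->] := pd i z.
  by have [] := gtrunc_hom z' i1.
- have [_ _ pb] := pm => i j x y xi yj ij.
  have [_ e] := gbr_hom xi yj ij.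
  by rewrite /= e pb /gbr -!morph_gemb.
Qed.

Lemma ker_graded_ideal : is_graded_ideal (fun x => p x = 0).
Proof.
have [_ _ pb] := pm; split=> [|i x /= px]; last first.
  by rewrite -/(hcomp i x) morph_hcomp px linear0.
split; first split=> [|a x y /= px py]; first exact: morph0.
  by rewrite morph_lin px py scaler0 addr0.
by move=> x y /= py; rewrite pb py linear0r.
Qed.

End GradedMorphisms.

(** * Minimal graded Lie algebras with a given local part *)

Section MinimalRealizations.
Variable K : fieldType.

Definition minimal (N : gradedLie K) : Prop :=
  forall J : set N, is_graded_ideal J -> meets_local_trivially J ->
    forall x, J x -> x = 0.

Lemma local_iso_comp (A B C : localLie K)
    (f : ltot A -> ltot B) (h : ltot B -> ltot C) :
  local_iso f -> local_iso h -> local_iso (fun w => h (f w)).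
Proof.
move=> [[fl fd fb] fbij] [[hl hd hb] hbij]; split; last exact: bij_comp.
split=> [a x y|i x xi|i j x y xi yj ij].
- by rewrite fl hl.
- exact/hd/fd.
- by rewrite (fb i j) // (hb i j) //; apply: fd.
Qed.

Lemma local_iso_id (A : localLie K) : local_iso (fun w : ltot A => w).
Proof. by split; [split | exists id]. Qed.

(** The image is a subalgebra, and the target is generated by its local
    part. *)
Lemma surj_of_local (G N : gradedLie K) (q : G -> N) : graded_morph q ->
  (forall w, exists x, q x = gemb w) -> forall y, exists x, q x = y.
Proof.
move=> qm qs; have [ql _ qb] := qm.
apply: ggen.
- split; first split; first by exists 0; apply: morph0.
    by move=> a _ _ [x <-] [y <-]; exists (a *: x + y); rewrite ql.
  by move=> _ _ [x <-] [y <-]; exists (lie x y); rewrite qb.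
- by move=> z; have [x e] := qs (z, 0, 0); exists x;
    rewrite e gembE /= !linear0 !addr0.
- by move=> z; have [x e] := qs (0, z, 0); exists x;
    rewrite e gembE /= !linear0 addr0 add0r.
- by move=> z; have [x e] := qs (0, 0, z); exists x;
    rewrite e gembE /= !linear0 !add0r.
Qed.

Lemma quotient_map (G M N : gradedLie K) (p : G -> M) (q : G -> N) :
    graded_morph p -> (forall y, exists x, p x = y) -> graded_morph q ->
    (forall x, p x = 0 -> q x = 0) ->
  exists2 F : M -> N, graded_morph F & forall x, F (p x) = q x.
Proof.
move=> pm /choice[s ps] qm pq.
have [pl _ pb] := pm; have [ql _ qb] := qm.
have Fp x : q (s (p x)) = q x.
  by apply/eqP; rewrite -subr_eq0 -morphB // pq // morphB // ps subrr.
exists (fun y => q (s y)) => //; split=> [a y z|i y|y z].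
- by rewrite -{1}[y]ps -{1}[z]ps -pl Fp ql.
- exists (gproj N i (q (s (ginj M i y)))).
  rewrite -/(hcomp _ _) -morph_hcomp // -[in RHS]Fp morph_hcomp // ps.
  by rewrite homog_inj.
- by rewrite -{1}[y]ps -{1}[z]ps -pb Fp qb.
Qed.

Lemma quotient_iso (G M N : gradedLie K) (p : G -> M) (q : G -> N) :
    graded_morph p -> (forall y, exists x, p x = y) ->
    graded_morph q -> (forall y, exists x, q x = y) ->
    (forall x, p x = 0 <-> q x = 0) ->
  graded_iso M N.
Proof.
move=> pm ps qm qs pq.
have [|F Fm Fp] := quotient_map pm ps qm; first by move=> x /pq.
have [|F' _ F'q] := quotient_map qm qs pm; first by move=> x /pq.
exists F => //; exists F' => [y|z].
  by have [x <-] := ps y; rewrite Fp F'q.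
by have [x <-] := qs z; rewrite F'q Fp.
Qed.

(** If J is a graded ideal of G meeting the local part trivially, then so is
    its image q(J) in N, because q is injective on the local part and J is
    graded; the minimality of N forces q(J) = 0, i.e. J is inside the kernel. *)
Lemma ker_Jmax (G N : gradedLie K) (q : G -> N) : graded_morph q ->
    (forall y, exists x, q x = y) -> (forall w, q (gemb w) = 0 -> gemb w = 0) ->
    minimal N ->
  is_Jmax (fun x => q x = 0).
Proof.
move=> qm qs qinj Nmin; have [ql _ qb] := qm.
split; [exact: ker_graded_ideal | exact: qinj | move=> J Jid Jtriv x Jx].
have [[[J0 JP] Jl] Jh] := Jid.
apply: (Nmin (fun y => exists2 z, J z & q z = y)); last by exists x.
  split; first split; first split; first by exists 0 => //; apply: morph0.
  - move=> a _ _ [z Jz <-] [t Jt <-]; exists (a *: z + t); first exact: JP.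
    by rewrite ql.
  - move=> y _ [t Jt <-]; have [z <-] := qs y.
    by exists (lie z t); [apply: Jl | rewrite qb].
  - move=> i _ [z Jz <-]; exists (hcomp i z); first exact: Jh.
    by rewrite morph_hcomp.
move=> w [z Jz qz].
(* q z lies in the local part, so it is the sum of its components of degree
   -1, 0, 1; these come from components of z in J and in the local part. *)
have h i : `|i| <= 1 -> hcomp i (q z) = 0.
  move=> i1; rewrite -morph_hcomp //.
  have [_ e] := gtrunc_hom (gproj G i z) i1.
  have Jz' : J (hcomp i z) by apply: Jh.
  rewrite -[hcomp i z]e (Jtriv (gtrunc (hcomp i z))) ?morph0 //.
  by rewrite /hcomp e.
by rewrite -[w]gembK gemb_trunc -qz !h // !addr0.
Qed.

(** The preimage in g_max(Ga) of a graded ideal of the quotient meeting the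
    local part trivially has the same property, as the quotient map is
    injective on the local part; hence it lies in J_max. *)
Lemma gmin_minimal (Ga : localLie K) (M : gradedLie K) : is_gmin Ga M ->
  minimal M /\ exists f : ltot Ga -> ltot (local_part M), local_iso f.
Proof.
move=> [G [iota [p [[iotaI _] pm ps [_ Jtriv Jmax]]]]].
have pinj w : p (gemb w) = 0 -> w = 0.
  by move=> /Jtriv e; rewrite -[w]gembK e linear0.
have [pl _ pb] := pm.
split.
  move=> J [[[J0 JP] Jl] Jh] JT x.
  have [z <-] := ps x; move: z; apply: Jmax.
    split; first split; first split.
    - by rewrite morph0.
    - by move=> a y z Jy Jz; rewrite pl; apply: JP.
    - by move=> y z Jz; rewrite pb; apply: Jl.
    - by move=> i z Jz; rewrite -/(hcomp i z) morph_hcomp //; apply: Jh.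
  move=> w; rewrite (morph_gemb pm) => /JT.
  by rewrite -(morph_gemb pm) => /pinj ->; rewrite linear0.
exists (fun w => gtrunc (p (gemb (iota w)))).
apply: (@local_iso_comp _ _ (local_part M) iota
  (fun w => gtrunc (p (gemb w))) iotaI).
split; first exact: local_morph_trunc.
have /choice[s hs] y : exists w, gtrunc (p (gemb w)) = y.
  have [x ex] := ps (gemb y); exists (gtrunc x).
  have [h eh] := linear_ex pl.
  rewrite gemb_trunc eh !linearD /= -eh !(morph_hcomp pm) ex -!linearD /=.
  by rewrite -gemb_trunc !gembK.
exists s => // w.
have /linear_ex[h eh] := pl.
apply/eqP; rewrite -subr_eq0; apply/eqP/pinj.
rewrite linearB (morphB pm) /= (morph_gemb pm) hs.
by rewrite -(morph_gemb pm) subrr.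
Qed.

(** Both M and N are quotients of g_max(Ga) by its ideal J_max. *)
Lemma gmin_unique (Ga : localLie K) (M N : gradedLie K)
    (f : ltot Ga -> ltot (local_part N)) :
  is_gmin Ga M -> local_iso f -> minimal N ->
  graded_iso M N /\ graded_iso N M.
Proof.
move=> [G [iota [p [[[[iotal _ _] [iota' iotaK iotaK']] univ] pm ps pJ]]]].
move=> [fm [f' fK fK']] Nmin; have [q [[qm qf] _]] := univ N f fm.
have qs : forall y, exists x, q x = y.
  apply: surj_of_local => // w.
  by exists (gemb (iota (f' w))); rewrite qf fK'.
have [fl _ _] := fm.
have qJ : is_Jmax (fun x => q x = 0).
  apply: ker_Jmax => // w; rewrite -[w]iotaK' qf => e.
  have /linear_ex[h eh] := fl.
  have : f (iota' w) = f 0 by rewrite -[LHS]gembK e eh !linear0.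
  by move=> /(can_inj fK) ->; have [k ->] := linear_ex iotal; rewrite !linear0.
have pq x : p x = 0 <-> q x = 0.
  have [p1 p2 p3] := pJ; have [q1 q2 q3] := qJ.
  by split=> [/(q3 _ p1 p2)|/(p3 _ q1 q2)].
have qp x : q x = 0 <-> p x = 0 by rewrite pq.
split; [exact: quotient_iso pq | exact: quotient_iso qp].
Qed.

End MinimalRealizations.
(** * Perfect pairings *)

Section PerfectPairing.
Variables (K : fieldType).

Lemma pairing_to_dual (U V : vectType K) (b : U -> V -> K^o) :
    (forall u, linear (b u)) -> (forall v, linear (b^~ v)) ->
    (forall u, (forall v, b u v = 0) -> u = 0) ->
  exists f : 'Hom(U, 'Hom(V, K^o)), (forall u v, f u v = b u v) /\ injective f.
Proof.
move=> bl br bn.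
have /choice[h hE] u : exists h : 'Hom(V, K^o), forall v, h v = b u v.
  have [h eh] := linear_ex (bl u); exists (linfun h) => v.
  by rewrite lfunE eh.
have hl : linear h.
  by move=> a u v; apply/lfunP => x; rewrite add_lfunE scale_lfunE !hE br.
have [H eH] := linear_ex hl.
exists (linfun H); have HE u : linfun H u = h u by rewrite lfunE eH.
split=> [u v|u v]; first by rewrite HE hE.
rewrite !HE eH => e; apply/eqP; rewrite -subr_eq0; apply/eqP/bn => w.
by rewrite -hE eH linearB /= e subrr lfunE.
Qed.

Lemma inj_dim_le (U V : vectType K) (f : 'Hom(U, V)) :
  injective f -> (dim U <= dim V)%N.
Proof.
move=> fi; have kf : lker f == 0%VS by apply/lker0P.
rewrite -!dimvf -(limg_dim_eq (f := f)) ?(eqP kf) ?capv0 //.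
exact/dimvS/subvf.
Qed.

(** Non-degeneracy on each side embeds each space in the dual of the other, so
    the dimensions agree and the embedding is onto. *)
Lemma perfect_pairing (U V : vectType K) (b : U -> V -> K^o) :
    (forall u, linear (b u)) -> (forall v, linear (b^~ v)) ->
    (forall u, (forall v, b u v = 0) -> u = 0) ->
    (forall v, (forall u, b u v = 0) -> v = 0) ->
  exists f : 'Hom(U, 'Hom(V, K^o)), (forall u v, f u v = b u v) /\ bijective f.
Proof.
move=> bl br bn bn'; have [f [fE fi]] := pairing_to_dual bl br bn.
have [f' [_ fi']] := @pairing_to_dual V U (fun v u => b u v) br bl bn'.
exists f; split=> //; have kf : lker f == 0%VS by apply/lker0P.
have fs : limg f = fullv.
  apply/eqP; rewrite eqEdim subvf limg_dim_eq ?(eqP kf) ?capv0 // !dimvf.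
  by have := inj_dim_le fi'; rewrite /dim /= !muln1.
exists (f^-1)%VF; first exact: lker0_lfunK.
by move=> x; apply: limg_lfunVK; rewrite fs memvf.
Qed.

End PerfectPairing.

(** * The local part as a local Lie algebra Gamma *)

Section LocalIdentification.
Variables (K : fieldType) (g : gradedLie K).
Variable B : {biscalar (ltot (local_part g))}.
Hypotheses (Binv : is_nondeg_inv_sym_form B) (Bgr : is_graded_form B).
Let B0 : invForm (deg0_alg g) := restr_form0 Binv Bgr.
Let g1 : lieRep (deg0_alg g) := deg_rep g 1.
Let T : vectType K := ltot (local_part g).

Let tneg (y : gpart g (-1)) : T := (y, 0, 0).
Let tzero (u : gpart g 0) : T := (0, u, 0).
Let tpos (x : gpart g 1) : T := (0, 0, x).

Lemma tneg_linear : linear tneg.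
Proof. by move=> a x y; apply: triple_ext; rewrite /= ?scaler0 ?addr0. Qed.

Lemma tpos_linear : linear tpos.
Proof. by move=> a x y; apply: triple_ext; rewrite /= ?scaler0 ?addr0. Qed.

Lemma triple_sum (w : T) : w = tneg w.1.1 + tzero w.1.2 + tpos w.2.
Proof. by apply: triple_ext; rewrite /= ?addr0 ?add0r. Qed.

Lemma tneg_hom y : lhom (-1) (tneg y). Proof. by constructor. Qed.
Lemma tzero_hom u : lhom 0 (tzero u). Proof. by constructor. Qed.
Lemma tpos_hom x : lhom 1 (tpos x). Proof. by constructor. Qed.

Lemma gbr_posneg x y :
  lbr (tpos x) (tneg y) = tzero (lbr (tpos x) (tneg y)).1.2.
Proof. exact: lhom0E (lbr_deg (tpos_hom x) (tneg_hom y) isT) erefl. Qed.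

Lemma gbr_act_pos u x : lbr (tzero u) (tpos x) = tpos (act_deg u x).
Proof.
rewrite /= /gbr !gembE /= !linear0 !addr0 !add0r -act_degE.
by apply: triple_ext; rewrite /= ?ginjK ?ginj_neq.
Qed.

Lemma gbr_act_neg u y : lbr (tzero u) (tneg y) = tneg (act_deg u y).
Proof.
rewrite /= /gbr !gembE /= !linear0 !addr0 !add0r -act_degE.
by apply: triple_ext; rewrite /= ?ginjK ?ginj_neq.
Qed.

(** The action of g_0 on g_(-1) is contragredient to the one on g_1. *)
Lemma form_act y u x :
  B (tneg (act_deg u y)) (tpos x) = - B (tneg y) (tpos (act_deg u x)).
Proof.
have [_ [Bi _]] := Binv.
rewrite -gbr_act_neg -gbr_act_pos (lbr_anti (tzero_hom u) (tneg_hom y)) //.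
by rewrite linearNl /= (Bi _ _ _ _ _ _ (tneg_hom y) (tzero_hom u) (tpos_hom x)).
Qed.

(** The defining equation of [moment], satisfied by the bracket of g. *)
Lemma form_moment x y u :
  B0 (lbr (tpos x) (tneg y)).1.2 u = B (tneg y) (tpos (act_deg u x)).
Proof.
have [Bs [Bi _]] := Binv.
transitivity (B (lbr (tpos x) (tneg y)) (tzero u)); first by rewrite gbr_posneg.
rewrite Bs -(Bi _ _ _ _ _ _ (tzero_hom u) (tpos_hom x) (tneg_hom y)) //.
by rewrite gbr_act_pos Bs.
Qed.

(** The form pairs degree i with degree -i only, so its non-degeneracy on the
    local part restricts to the pairing of g_(-1) with g_1. *)
Lemma dual_identification : exists f : 'Hom(gpart g (-1), dual g1),
  (forall y x, f y x = B (tneg y) (tpos x)) /\ bijective f.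
Proof.
have [Bs [_ Bn]] := Binv.
apply: (@perfect_pairing _ _ _ (fun y x => B (tneg y) (tpos x))).
- by move=> y a x x'; rewrite tpos_linear linearPr.
- by move=> x a y y'; rewrite tneg_linear linearPl.
- move=> y y0; have [] // : tneg y = 0.
  apply: Bn => w; rewrite [w]triple_sum !linearDr /= y0 addr0.
  rewrite (Bgr (tneg_hom _) (tneg_hom _)) // add0r.
  by rewrite (Bgr (tneg_hom _) (tzero_hom _)).
- move=> x x0; have [] // : tpos x = 0.
  apply: Bn => w; rewrite Bs [w]triple_sum !linearDl /= x0 add0r.
  rewrite (Bgr (tpos_hom _) (tpos_hom _)) // addr0.
  by rewrite (Bgr (tzero_hom _) (tpos_hom _)).
Qed.

Lemma dual_rep_iso : exists f : deg_rep g (-1) -> contragredient g1,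
  rep_iso f /\ forall y x, f y x = B (tneg y) (tpos x).
Proof.
have [f [fE fbij]] := dual_identification.
exists f; split=> //; split; first by move=> a x y; rewrite linearP.
split=> // u y; apply/lfunP => x.
by rewrite fE [LHS]form_act -fE coactE.
Qed.

Lemma local_part_Gamma : exists f : ltot (local_part g) -> ltot (Gamma B0 g1),
  local_iso f.
Proof.
have [f [fE [f' fK fK']]] := dual_identification.
pose F (w : T) : ltot (Gamma B0 g1) := (f w.1.1, w.1.2, w.2).
exists F; split; last first.
  exists (fun w => (f' w.1.1, w.1.2, w.2)) => -[[y u] x]; rewrite /F /=.
    by rewrite fK.
  by rewrite fK'.
have f_act (u : deg0_alg g) y : f (act_deg u y) = coact u (f y).
  by apply/lfunP => x; rewrite fE [LHS]form_act -fE coactE.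
have f_moment x y : moment B0 x (f y) = (lbr (tpos x) (tneg y)).1.2.
  by apply: (form_inj (B0 := B0)) => u; rewrite momentE form_moment fE.
have Fl : linear F.
  by move=> a x y; apply: triple_ext; rewrite //= linearP.
have Fd i w : lhom i w -> lhom i (F w).
  by case=> z; rewrite /F /= ?linear0; constructor.
(* Anticommutativity leaves one order of each pair of degrees to check. *)
have sym i j x y : lhom i x -> lhom j y -> `|i + j| <= 1 ->
    F (lbr y x) = lbr (F y) (F x) -> F (lbr x y) = lbr (F x) (F y).
  move=> xi yj ij e; rewrite (lbr_anti xi yj ij).
  rewrite (lbr_anti (Fd _ _ xi) (Fd _ _ yj) ij) -e.
  by have [h ->] := linear_ex Fl; rewrite linearN.
have F_zero_zero u v :
    F (lbr (tzero u) (tzero v)) = lbr (F (tzero u)) (F (tzero v)).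
  have -> : lbr (tzero u) (tzero v) = tzero (act_deg u v).
    by symmetry; exact: (@gbr0E K g u v).
  by apply: triple_ext; rewrite /= ?linear0 ?linear0l ?linear0r ?subrr ?addr0.
have F_zero_pos u x :
    F (lbr (tzero u) (tpos x)) = lbr (F (tzero u)) (F (tpos x)).
  rewrite gbr_act_pos.
  by apply: triple_ext;
    rewrite /= ?linear0 ?linear0l ?linear0r ?subrr ?subr0 ?addr0.
have F_zero_neg u y :
    F (lbr (tzero u) (tneg y)) = lbr (F (tzero u)) (F (tneg y)).
  rewrite gbr_act_neg.
  by apply: triple_ext;
    rewrite /= ?linear0 ?linear0l ?linear0r ?f_act ?subrr ?subr0 ?addr0.
have F_pos_neg x y :
    F (lbr (tpos x) (tneg y)) = lbr (F (tpos x)) (F (tneg y)).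
  rewrite gbr_posneg.
  by apply: triple_ext;
    rewrite /= ?linear0 ?linear0l ?linear0r ?f_moment ?subrr ?subr0 ?add0r.
split=> // i j x y xi yj.
case: xi (xi) => [Y1|u1|X1] h1; case: yj (yj) => [Y2|u2|X2] h2 ij //.
- exact: (sym _ _ _ _ h1 h2 ij (F_zero_neg _ _)).
- exact: (sym _ _ _ _ h1 h2 ij (F_pos_neg _ _)).
- exact: F_zero_neg.
- exact: F_zero_zero.
- exact: F_zero_pos.
- exact: F_pos_neg.
- exact: (sym _ _ _ _ h1 h2 ij (F_zero_pos _ _)).
Qed.

End LocalIdentification.

(** * Linear independence in a finite-dimensional Lie algebra *)

Section LinearIndependence.
Variables (K : fieldType) (L : lieAlg K).

(** Families are indexed by all natural numbers, with only the first k values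
    relevant, so that adding a vector does not change the index type. *)
Definition indep k (x : nat -> L) : Prop := forall c : nat -> K,
  \sum_(j < k) c j *: x j = 0 -> forall j, (j < k)%N -> c j = 0.

(** The coordinates of an independent family of size k on n generators form
    a row-free k x n matrix. *)
Lemma indep_bound : fin_dim L ->
  exists n, forall k x, indep k x -> (k <= n)%N.
Proof.
case=> n [e eP]; exists n => k x xi.
have /choice[a aE] := eP.
pose A : 'M[K]_(k, n) := \matrix_(i, j) a (x i) j.
suff /eqP <- : row_free A by apply: rank_leq_col.
apply/row_freeP/row_freeP; rewrite -kermx_eq0; apply/eqP/row_matrixP => i.
rewrite row0; set r := row i _.
have rA : r *m A = 0.
  by rewrite -row_mul mulmx_ker row0.
pose c j := if insub j is Some j' then r 0 j' else 0.
have cE (j : 'I_k) : c j = r 0 j by rewrite /c valK.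
apply/rowP => j; rewrite [RHS]mxE -cE; apply: xi => //.
under eq_bigr => l _ do rewrite (aE (x l)) scaler_sumr.
rewrite exchange_big big1 //= => m _.
under eq_bigr => l _ do rewrite scalerA cE.
rewrite -scaler_suml; have -> : \sum_l r 0 l * a (x l) m = (r *m A) 0 m.
  by rewrite [RHS]mxE; apply: eq_bigr => l _; rewrite [A l m]mxE.
by rewrite rA mxE scale0r.
Qed.

Lemma indep_extend k x (S : set L) v : is_subspace S ->
    (forall j, (j < k)%N -> S (x j)) -> ~ S v -> indep k x ->
  indep k.+1 (fun j => if j == k then v else x j).
Proof.
move=> Ssub Sx Sv xi c; rewrite big_ord_recr /= eqxx.
have -> : \sum_(j < k) c j *: (if (j : nat) == k then v else x j) =
          \sum_(j < k) c j *: x j.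
  by apply: eq_bigr => j _; rewrite ltn_eqF.
move=> c0; have ck : c k = 0.
  apply/eqP/negPn/negP => ck; apply: Sv.
  have -> : v = (- (c k)^-1) *: \sum_(j < k) c j *: x j.
    move/eqP: c0; rewrite addr_eq0 => /eqP ->.
    by rewrite scaleNr scalerN opprK scalerA mulVf // scale1r.
  apply: subspaceZ => //; apply: subspace_sum => // j _; apply: subspaceZ => //.
  exact: Sx.
move: c0; rewrite ck scale0r addr0 => /xi cj j.
by rewrite ltnS leq_eqVlt => /orP[/eqP ->|/cj].
Qed.

End LinearIndependence.

(** * The Engel theorem for homogeneous elements *)

Section Engel.
Variables (K : fieldType) (g : gradedLie K).
Implicit Types (H I U V S : set g).

Definition graded_set S := forall i x, S x -> S (hcomp i x).

Definition stable H S := forall h x, H h -> S x -> S (lie h x).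

(** The quotient V / (U cap V), when nonzero, has a nonzero homogeneous
    vector killed by H; stated for pairs of H-stable subspaces U, V of g to
    avoid forming the quotient. *)
Definition engel H := forall U V, is_subspace U -> graded_set U ->
  graded_set V -> stable H U -> stable H V -> (exists2 v, V v & ~ U v) ->
  exists i w, [/\ homog i w, V w, ~ U w & forall h, H h -> U (lie h w)].

(** Each generator has components in finitely many degrees only. *)
Lemma bounded_degrees : fin_dim g ->
  exists N : nat, forall i (x : g), (N < `|i|)%N -> hcomp i x = 0.
Proof.
case=> n [e eP].
have /choice[s sE] (j : 'I_n) : exists s : seq int,
    forall i, i \notin s -> hcomp i (e j) = 0.
  have [s su es] := hcomp_decomp (e j); exists s => i si.
  rewrite es linear_sum big_seq big1 //= => l ls.
  rewrite (hcomp_homog i (homog_hcomp l _)); case: eqP => // il.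
  by rewrite il ls in si.
exists (\max_j \max_(l <- s j) `|l|)%N => i x Ni.
have [c ->] := eP x; rewrite linear_sum big1 //= => j _.
rewrite linearZ /= sE ?scaler0 //; apply: contraL Ni => si; rewrite -leqNgt.
apply: leq_trans (leq_bigmax j).
exact: (@leq_bigmax_seq _ (s j) xpredT absz i).
Qed.

(** Some homogeneous component of a vector outside U is outside U. *)
Lemma engel0 : engel (fun h => h = 0).
Proof.
move=> U V Us _ Vg _ _ [v Vv Uv].
have [i Ui] : exists i, ~ U (hcomp i v).
  apply: contrapT => nU; apply: Uv; have [s _ ->] := hcomp_decomp v.
  by apply: subspace_sum => // i _; apply: contrapT => ni; apply: nU; exists i.
exists i, (hcomp i v); split=> //; [exact: homog_hcomp | exact: Vg |].
by move=> _ ->; rewrite linear0l; apply: subspace0.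
Qed.

Definition adjoin H (x : g) : set g := fun z => exists2 h, H h &
  exists a, z = h + a *: x.

Lemma sub_adjoin H x h : H h -> adjoin H x h.
Proof. by exists h => //; exists 0; rewrite scale0r addr0. Qed.

Lemma mem_adjoin H x : H 0 -> adjoin H x x.
Proof. by exists 0 => //; exists 1; rewrite scale1r add0r. Qed.

Lemma adjoin_subalgebra H x : is_subalgebra H ->
  (forall h, H h -> H (lie h x)) -> is_subalgebra (adjoin H x).
Proof.
move=> [Hs Hl] Hx; split; first split.
- exact: sub_adjoin (subspace0 Hs).
- move=> a _ _ [h Hh [b ->]] [k Hk [c ->]].
  exists (a *: h + k); first by case: Hs => _; apply.
  by exists (a * b + c); rewrite scalerDr scalerDl scalerA addrACA.
- move=> _ _ [h Hh [b ->]] [k Hk [c ->]].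
  exists (lie h k + (c *: lie h x - b *: lie k x)); last first.
    exists 0; rewrite scale0r addr0 linearDl !linearDr /=.
    by rewrite !linearZr !linearZl /= liexx !scaler0 addr0
      (lieC x k) scalerN addrA.
  apply: subspaceD => //; first exact: Hl.
  apply: subspaceD => //; first by apply: subspaceZ => //; apply: Hx.
  by rewrite -scaleNr; apply: subspaceZ => //; apply: Hx.
Qed.

Lemma adjoin_graded H i x : is_subspace H -> graded_set H -> homog i x ->
  graded_set (adjoin H x).
Proof.
move=> Hs Hg xi j _ [h Hh [a ->]]; exists (hcomp j h); first exact: Hg.
exists (if j == i then a else 0).
by rewrite linearD linearZ /= (hcomp_homog j xi); case: eqP;
  rewrite ?scaler0 ?scale0r.
Qed.

Lemma homog_iter i d (x w : g) k : homog i x -> homog d w ->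
  homog (i *+ k + d) (iter k (lie x) w).
Proof.
move=> xi wd; elim: k => [|k IH] /=; first by rewrite mulr0n add0r.
by rewrite mulrS -addrA; apply: homog_lie.
Qed.

(** The degrees of the iterates leave the bounded set of degrees of g. *)
Lemma ad_nilpotent i d (x w : g) :
    fin_dim g -> homog i x -> i != 0 -> homog d w ->
  exists k, iter k (lie x) w = 0.
Proof.
move=> /bounded_degrees[N hN] xi i0 wd; exists (N + `|d|).+1.
rewrite -(homog_iter (N + `|d|).+1 xi wd) hN //.
set k := (N + `|d|).+1.
have : (k <= `|i *+ k|)%N.
  by rewrite -mulr_natr natz abszM absz_nat leq_pmull // absz_gt0.
move: (i *+ k) => q; rewrite /k; lia.
Qed.

(** Given w in V, outside U, with H w in U, the vectors x^k w also have
    H x^k w in U, as x normalizes H.  The last of them outside U is sent into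
    U by x as well. *)
Lemma engel_adjoin H i x : fin_dim g -> is_subspace H -> homog i x -> i != 0 ->
    (forall h, H h -> H (lie h x)) -> engel H ->
  engel (adjoin H x).
Proof.
move=> fg Hs xi i0 Hx He U V Us Ug Vg HU HV UV.
have [||d [w [wd Vw Uw Hw]]] := He U V Us Ug Vg _ _ UV.
- by move=> h y /(@sub_adjoin _ x); apply: HU.
- by move=> h y /(@sub_adjoin _ x); apply: HV.
pose y k := iter k (lie x) w.
have xx := mem_adjoin x (subspace0 Hs).
have yV k : V (y k) by elim: k => [//|k IH]; apply: HV.
have yH k h : H h -> U (lie h (y k)).
  elim: k h => [|k IH] h Hh; first exact: Hw.
  have := lie_der (lieP g) h x (y k).
  move/eqP; rewrite eq_sym subr_eq => /eqP ->.
  by apply: subspaceD; [|apply/IH/Hx|apply: HU => //; apply: IH].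
have ex : exists k, `[< U (y k) >].
  have [k yk] := ad_nilpotent fg xi i0 wd; exists k; apply/asboolP.
  by rewrite /y yk; apply: subspace0.
case: (ex_minnP ex) => -[|k] /asboolP Uk kmin //.
exists (i *+ k + d), (y k); split=> //; first exact: homog_iter.
  by move=> /asboolP /kmin; rewrite ltnn.
move=> _ [h Hh [a ->]]; rewrite linearDl linearZl /=.
by apply: subspaceD => //; [exact: yH | apply: subspaceZ].
Qed.

(** Take a graded subalgebra H of I with the Engel property and containing an
    independent family as large as possible.  If H were not I, the property
    applied to the H-module I / H would give a homogeneous w in I, outside H,
    that normalizes H; its degree is not 0, so H + K w would have the Engel
    property too, against the maximality of H. *)
Lemma engel_theorem I : fin_dim g -> is_subalgebra I -> graded_set I ->
  (forall x, I x -> hcomp 0 x = 0) -> engel I.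
Proof.
move=> fg Ialg Ig I0.
pose Q k := exists H, [/\ is_subalgebra H, graded_set H,
  forall x, H x -> I x, engel H &
  exists2 x, indep k x & forall j, (j < k)%N -> H (x j)].
have Q0 : exists k, `[< Q k >].
  exists 0%N; apply/asboolP; exists (fun h => h = 0); split=> //.
  - split; first split=> // a _ _ -> ->; first by rewrite scaler0 addr0.
    by move=> _ _ -> ->; rewrite linear0l.
  - by move=> i _ ->; rewrite linear0.
  - by move=> _ ->; case: Ialg => -[].
  - exact: engel0.
  - by exists (fun=> 0).
have [n nP] := indep_bound fg.
have Qn k : `[< Q k >] -> (k <= n)%N.
  by move=> /asboolP[H [_ _ _ _ [x xi _]]]; apply: nP xi.
case: (ex_maxnP Q0 Qn) => k /asboolP[H [Halg Hg HI He [x xi Hx]]] kmax.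
have IH v : I v -> H v.
  move=> Iv; apply: contrapT => nHv.
  have [Hs Hl] := Halg; have [Is Il] := Ialg.
  have [|||i [w [wi Iw nHw Hw]]] := He H I Hs Hg Ig; first exact: Hl.
  - by move=> h y Hh; apply/Il/HI.
  - by exists v.
  have i0 : i != 0.
    by apply/eqP => i0; apply: nHw; rewrite -wi i0 I0 //; apply: subspace0.
  suff /asboolP/kmax : Q k.+1 by rewrite ltnn.
  exists (adjoin H w); split.
  - exact: adjoin_subalgebra.
  - exact: adjoin_graded wi.
  - by move=> _ [h Hh [a ->]]; apply: subspaceD;
      [|exact: HI | exact: subspaceZ].
  - exact: (engel_adjoin (i := i)).
  exists (fun j => if j == k then w else x j); first exact: indep_extend nHw xi.
  move=> j; rewrite ltnS leq_eqVlt => /orP[/eqP ->|jk].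
    by rewrite eqxx; apply: mem_adjoin (subspace0 Hs).
  by rewrite ltn_eqF //; apply/sub_adjoin/Hx.
move=> U V Us Ug Vg IU IV UV.
have [||i [w [wi Vw Uw Hw]]] := He U V Us Ug Vg _ _ UV.
- by move=> h y /HI; apply: IU.
- by move=> h y /HI; apply: IV.
by exists i, w; split=> // h /IH; apply: Hw.
Qed.

(** See the introduction: such an ideal would contain a nonzero central element
    of [g, g], which is impossible when every ideal has a complement. *)
Lemma reductive_minimal : fin_dim g -> reductive g -> minimal g.
Proof.
move=> fg red I [Iid Ig] Itriv v Iv; apply: contrapT => v0.
have [Is Il] := Iid.
have Ilow i x : I x -> `|i| <= 1 -> hcomp i x = 0.
  move=> Ix i1; have [_ e] := gtrunc_hom (gproj g i x) i1.
  by rewrite /hcomp -e; apply: Itriv; rewrite e; apply: Ig.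
have IE : engel I.
  apply: engel_theorem => //; last by move=> x Ix; apply: Ilow.
  by split=> // x y _; apply: Il.
have [|||||i [z [zi Iz z0 Hz]]] := IE (fun x => x = 0) I _ _ Ig.
- by split=> // a _ _ -> ->; rewrite scaler0 addr0.
- by move=> j _ ->; rewrite linear0.
- by move=> h _ _ ->; rewrite linear0r.
- by move=> h x _; apply: Il.
- by exists v.
have [I' [[I's I'l] [II' I0]]] := red I Iid.
(* I and I' commute, being complementary ideals, so z is central in g. *)
have zC x : lie x z = 0.
  have [y [t [Iy [It ->]]]] := II' x; rewrite linearDl /= Hz // add0r.
  by apply: I0; [exact: Il | apply: ideal_lieC].
have zid : is_ideal (fun x => exists a, x = a *: z).
  split; first split; first by exists 0; rewrite scale0r.
    by move=> a _ _ [b ->] [c ->]; exists (a * b + c); rewrite scalerDl scalerA.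
  by move=> x _ [a ->]; exists 0; rewrite linearZr /= zC scaler0 scale0r.
have [C [[Cs Cl] [zCg C0]]] := red _ zid.
have gC x y : C (lie x y).
  have [_ [t [[a ->] [Ct ->]]]] := zCg x.
  rewrite linearDl linearZl /= lieC zC oppr0 scaler0 add0r.
  exact: ideal_lieC.
(* The elements with all components of degree outside {-1, 0, 1} in C form a
   subalgebra containing the local part, hence all of g. *)
have hC : forall x k, 1 < `|k| -> C (hcomp k x).
  apply: ggen.
  - split; first split.
    + by move=> k _; rewrite linear0; apply: subspace0.
    + by move=> a x y Cx Cy k k1; rewrite linearP; case: Cs => _; apply;
        [apply: Cx | apply: Cy].
    + move=> x y _ _ k _.
      have [s _ ->] := hcomp_decomp x; have [t _ ->] := hcomp_decomp y.
      rewrite -(applyrE lie) !linear_sum.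
      apply: subspace_sum => // m _.
      rewrite /= linear_sum linear_sum; apply: subspace_sum => // n _ /=.
      rewrite (hcomp_homog k (homog_lie (homog_hcomp m x) (homog_hcomp n y))).
      by case: ifP => _; [exact: gC | exact: subspace0].
  - by move=> x k; rewrite hcomp_inj; case: eqP => [->//|_ _]; apply: subspace0.
  - by move=> x k; rewrite hcomp_inj; case: eqP => [->//|_ _]; apply: subspace0.
  - by move=> x k; rewrite hcomp_inj; case: eqP => [->//|_ _]; apply: subspace0.
apply: z0; rewrite -zi; have [i1|i1] := lerP `|i| 1; first exact: Ilow.
apply: C0; first by exists 1; rewrite scale1r.
exact: hC.
Qed.

End Engel.

(** * The isomorphisms *)

Theorem proposition3p3p2 (R : realType) (g : gradedLie R[i])
    (B : {biscalar (ltot (local_part g))})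
    (Binv : is_nondeg_inv_sym_form B) (Bgr : is_graded_form B) :
  let B0 : invForm (deg0_alg g) := restr_form0 Binv Bgr in
  let g1 : lieRep (deg0_alg g) := deg_rep g 1 in
  [/\ exists f : deg_rep g (-1) -> contragredient g1,
        rep_iso f /\
        forall (y : gpart g (-1)) (x : gpart g 1),
          f y x = B (y, 0, 0) (0, 0, x),
      forall M N : gradedLie R[i],
        is_gmin (local_part g) M -> is_gmin (Gamma B0 g1) N ->
        graded_iso M N
    & fin_dim g -> reductive g ->
      forall M N : gradedLie R[i],
        is_gmin (local_part g) M -> is_gmin (Gamma B0 g1) N ->
        graded_iso g M /\ graded_iso M N].
Proof.
move=> B0 g1.
have MN (M N : gradedLie R[i]) : is_gmin (local_part g) M ->
    is_gmin (Gamma B0 g1) N -> graded_iso M N.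
  move=> gM /gmin_minimal[Nmin [f fI]].
  have [h hI] := local_part_Gamma Binv Bgr.
  by have [] := gmin_unique gM (local_iso_comp hI fI) Nmin.
split=> //; first exact: dual_rep_iso.
move=> fg red M N gM gN; split; last exact: MN gN.
by have [] := gmin_unique gM (local_iso_id _) (reductive_minimal fg red).
Qed.
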